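(* Let $A\in\mathbb{C}^{n\times n}$ be Hermitian with eigenvalues $\lambda_1\ge\cdots\ge\lambda_n$. Consider the restarted block Lanczos method with block size $p$ and degree $k$ (defined in the context), with iterative subspaces $\mathcal{Y}^{(\ell)}$ and Ritz values $\psi_1^{(\ell)}\ge\cdots\ge\psi_p^{(\ell)}$ of $A$ in $\mathcal{Y}^{(\ell)}$. Let $T_k$ be the Chebyshev polynomial (of the first kind) of degree $k$, and let $i\in\{1,\ldots,p\}$. (a) If $\psi_p^{(\ell)}>\lambda_{t+1}$ for a certain $t\in\{p,\ldots,n-1\}$, then either $\psi_i^{(\ell+1)}\ge\lambda_{t-p+i}$, or $$0<\frac{\lambda_{t-p+i}-\psi_i^{(\ell+1)}}{\psi_i^{(\ell+1)}-\lambda_{t+1}}\le\left[T_k\left(1+2\,\frac{\lambda_{t-p+i}-\lambda_{t+1}}{\lambda_{t+1}-\lambda_n}\right)\right]^{-2}\frac{\lambda_{t-p+i}-\psi_p^{(\ell)}}{\psi_p^{(\ell)}-\lambda_{t+1}}.$$ In the latter case, consider orthonormal eigenvectors $x_1,\ldots,x_n$ of $A$ associated with $\lambda_1,\ldots,\lambda_n$. Then the subspace $\widetilde{\mathcal{Y}}=\mathrm{span}\{x_{t-p+i+1},\ldots,x_t\}^{\perp}\cap\mathcal{Y}^{(\ell)}$ has at least dimension $i$. By using the smallest ($i$th largest) Ritz value $\widetilde{\eta}_i$ of $A$ in an arbitrary $i$-dimensional subspace $\widetilde{\mathcal{Y}}_i\subseteq\widetilde{\mathcal{Y}}$, it holds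 that $$0<\frac{\lambda_{t-p+i}-\psi_i^{(\ell+1)}}{\psi_i^{(\ell+1)}-\lambda_{t+1}}\le\left[T_k\left(1+2\,\frac{\lambda_{t-p+i}-\lambda_{t+1}}{\lambda_{t+1}-\lambda_n}\right)\right]^{-2}\frac{\lambda_{t-p+i}-\widetilde{\eta}_i}{\widetilde{\eta}_i-\lambda_{t+1}}.$$ (b) If $\psi_i^{(\ell)}>\lambda_{t+1}$ for a certain $t\in\{i,\ldots,n-p+i-1\}$, then either $\psi_i^{(\ell+1)}\ge\lambda_t$, or $$0<\frac{\lambda_t-\psi_i^{(\ell+1)}}{\psi_i^{(\ell+1)}-\lambda_{t+1}}\le\left[T_k\left(1+2\,\frac{\lambda_t-\lambda_{t+1}}{\lambda_{t+1}-\lambda_n}\right)\right]^{-2}\frac{\lambda_t-\psi_i^{(\ell)}}{\psi_i^{(\ell)}-\lambda_{t+1}}.$$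
   Context: Eigenvalues are counted with multiplicity; $\perp$ refers to the Euclidean inner product (and the orthogonal complement of the span of the empty set, which occurs for $i=p$, is $\mathbb{C}^n$). For a subspace $\mathcal{U}\subseteq\mathbb{C}^n$ of dimension $d\ge1$ with orthonormal basis matrix $U\in\mathbb{C}^{n\times d}$, the Ritz values of $A$ in $\mathcal{U}$ are the $d$ eigenvalues (with multiplicity) of $U^HAU$, ordered decreasingly; a Ritz vector associated with a Ritz value $\eta$ is a vector $Ug$ where $g\neq0$ is an eigenvector of $U^HAU$ for $\eta$. Restarted block Lanczos method: $\mathcal{Y}^{(\ell)}\subseteq\mathbb{C}^n$ is a $p$-dimensional subspace, and $\mathcal{Y}^{(\ell+1)}$ is the $p$-dimensional subspace spanned by $p$ orthonormal Ritz vectors associated with the $p$ largest Ritz values of $A$ in the block Krylov subspace $\mathcal{Y}^{(\ell)}+A\mathcal{Y}^{(\ell)}+\cdots+A^k\mathcal{Y}^{(\ell)}$. Passing from $\mathcal{Y}^{(\ell)}$ to $\mathcal{Y}^{(\ell+1)}$ is one outer step. *)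

(* Defs.v *)
From HB Require Import structures.
From mathcomp Require Import all_boot all_order all_algebra.
From mathcomp Require Import sesquilinear spectral.
From mathcomp Require Import reals.
From mathcomp Require Export complex.

Set Implicit Arguments.
Unset Strict Implicit.
Unset Printing Implicit Defensive.

Import Order.TTheory GRing.Theory Num.Theory.

Local Open Scope ring_scope.
Local Open Scope complex_scope.
Local Open Scope sesquilinear_scope.

(* Vectors of C^n are columns 'cV[R[i]]_n with R[i] the complex numbers over
   the reals R. Families indexed by 1, 2, ... (eigenvalues, Ritz values,
   eigenvectors) are functions on nat; their values outside the index range in
   question are irrelevant. *)

Definition inner (R : realType) (n : nat) (u v : 'cV[R[i]]_n) : R[i] :=
  (u^t* *m v) 0 0.

Definition orthonormal_family (R : realType) (n m : nat)
    (x : nat -> 'cV[R[i]]_n) : Prop :=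
  forall j l : nat, (1 <= j <= m)%N -> (1 <= l <= m)%N ->
    inner (x j) (x l) = (j == l)%:R.

Definition mximg (R : realType) (m n : nat) (M : 'M[R[i]]_(m, n))
    (V : {vspace 'cV[R[i]]_n}) : {vspace 'cV[R[i]]_m} :=
  (linfun (mulmx M : 'cV[R[i]]_n -> 'cV[R[i]]_m) @: V)%VS.

Definition orth_compl (R : realType) (n : nat) (V : {vspace 'cV[R[i]]_n}) :
    {vspace 'cV[R[i]]_n} :=
  (\bigcap_(u <- vbasis V)
     lker (linfun (mulmx (u^t*) : 'cV[R[i]]_n -> 'M[R[i]]_1)))%VS.

Lemma mem_mximg (R : realType) (m n : nat) (M : 'M[R[i]]_(m, n))
    (V : {vspace 'cV[R[i]]_n}) (w : 'cV[R[i]]_m) :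
  w \in mximg M V <-> exists2 v, v \in V & w = M *m v.
Proof.
split=> [/memv_imgP[v vV ->]|[v vV ->]]; first by exists v; rewrite ?lfunE.
by apply/memv_imgP; exists v; rewrite ?lfunE.
Qed.

Lemma mem_orth_compl (R : realType) (n : nat) (V : {vspace 'cV[R[i]]_n})
    (v : 'cV[R[i]]_n) :
  v \in orth_compl V <-> forall u, u \in V -> inner u v = 0.
Proof.
have -> : (v \in orth_compl V) = all (fun u => inner u v == 0) (vbasis V).
  rewrite /orth_compl; elim: (tval (vbasis V)) => [|u s IHs] /=.
    by rewrite big_nil memvf.
  rewrite big_cons memv_cap IHs memv_ker lfunE /=; congr (_ && _).
  by apply/eqP/eqP => [h|h]; [rewrite /inner h mxE
    | apply/matrixP => a b; rewrite !ord1 [RHS]mxE; exact: h].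
split=> [/allP h u /coord_vbasis -> | h]; last first.
  by apply/allP => u uV; apply/eqP/h/vbasis_mem.
rewrite /inner raddf_sum /= map_mx_sum mulmx_suml summxE big1 // => j _.
have jV : (vbasis V)`_j \in vbasis V by rewrite mem_nth // size_tuple.
have := eqP (h _ jV); rewrite /inner => hj.
by rewrite linearZ /= map_mxZ -scalemxAl mxE hj mulr0.
Qed.

(* mu 1 >= ... >= mu d are the eigenvalues of M, with multiplicity *)
Definition eigenvalues_decr (R : realType) (d : nat) (M : 'M[R[i]]_d)
    (mu : nat -> R) : Prop :=
  char_poly M = \prod_(1 <= j < d.+1) ('X - ((mu j)%:C)%:P) /\
  (forall j l : nat, (1 <= j)%N -> (j <= l)%N -> (l <= d)%N -> mu l <= mu j).

Definition orthonormal_basis_mx (R : realType) (n d : nat)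
    (U : 'M[R[i]]_(n, d)) (V : {vspace 'cV[R[i]]_n}) : Prop :=
  U^t* *m U = 1%:M /\ mximg U fullv = V.

Definition ritz_values (R : realType) (n : nat) (A : 'M[R[i]]_n)
    (V : {vspace 'cV[R[i]]_n}) (eta : nat -> R) : Prop :=
  exists2 U : 'M[R[i]]_(n, \dim V),
    orthonormal_basis_mx U V & eigenvalues_decr (U^t* *m A *m U) eta.

Definition ritz_vector (R : realType) (n : nat) (A : 'M[R[i]]_n)
    (V : {vspace 'cV[R[i]]_n}) (eta : R) (v : 'cV[R[i]]_n) : Prop :=
  exists (U : 'M[R[i]]_(n, \dim V)) (g : 'cV[R[i]]_(\dim V)),
    [/\ orthonormal_basis_mx U V, g != 0,
        (U^t* *m A *m U) *m g = eta%:C *: g & v = U *m g].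

Definition block_krylov (R : realType) (n : nat) (A : 'M[R[i]]_n)
    (Y : {vspace 'cV[R[i]]_n}) (k : nat) : {vspace 'cV[R[i]]_n} :=
  (\sum_(j < k.+1) mximg (A ^+ j) Y)%VS.

Definition lanczos_step (R : realType) (n : nat) (A : 'M[R[i]]_n) (p k : nat)
    (Y Y' : {vspace 'cV[R[i]]_n}) : Prop :=
  exists (theta : nat -> R) (y : nat -> 'cV[R[i]]_n),
    [/\ ritz_values A (block_krylov A Y k) theta,
        orthonormal_family p y,
        forall j : nat, (1 <= j <= p)%N ->
          ritz_vector A (block_krylov A Y k) (theta j) (y j) &
        Y' = (\sum_(1 <= j < p.+1) <[y j]>)%VS].

Definition restarted_block_lanczos (R : realType) (n : nat) (A : 'M[R[i]]_n)
    (p k : nat) (Y : nat -> {vspace 'cV[R[i]]_n}) : Prop :=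
  forall l : nat, \dim (Y l) = p /\ lanczos_step A p k (Y l) (Y l.+1).

Fixpoint chebyshevT (R : realType) (k : nat) : {poly R} :=
  match k with
  | 0 => 1
  | k1.+1 => match k1 with
             | 0 => 'X
             | k2.+1 => 2%:P * 'X * chebyshevT R k1 - chebyshevT R k2
             end
  end.

(* [T_k (1 + 2 (a - b) / (b - c))]^-2. For b = c (which is always the case when
   b = lambda_(t+1) with t = n - 1) the quotient is read as +oo, so that the
   value is the limit: 0 if k > 0, and 1 for the constant T_0. *)
Definition chebyshev_factor (R : realType) (k : nat) (a b c : R) : R :=
  if b == c then (k == 0)%:R
  else (chebyshevT R k).[1 + 2 * ((a - b) / (b - c))] ^- 2.

(* Main.v *)
Require Import Defs.
From HB Require Import structures.
From mathcomp Require Import all_boot all_order all_algebra.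
From mathcomp Require Import sesquilinear spectral.
From mathcomp Require Import ring lra zify.
From mathcomp Require Import perm reals complex.

Set Implicit Arguments.
Unset Strict Implicit.
Unset Printing Implicit Defensive.

Import Order.TTheory GRing.Theory Num.Theory.

Local Open Scope ring_scope.
Local Open Scope complex_scope.
Local Open Scope sesquilinear_scope.

(** One outer step cannot do worse than any polynomial filter of degree at most
    k: for a subspace W of the current iterate and a real polynomial q with
    deg q <= k, the block Krylov subspace contains q(A)W, so by the min-max
    principle its i-th Ritz value, hence also the i-th Ritz value of the new
    iterate, is at least the smallest Rayleigh quotient on an i-dimensional
    q(A)W ([lanczos_ritz_lower]).

    All Rayleigh quotient estimates are carried by the quadratic form
    w^* A w - tau w^* w ([rayleigh_gap]), which is diagonal in an orthonormal
    basis of Ritz vectors.  In an eigenbasis, q(A) multiplies the j-th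
    coordinate by q(lambda_j).  Hence, if kappa >= 0 and
      kappa (lambda - eta) <= q(lambda)^2 (lambda - tau)
    at all eigenvalues in which vectors of W have a component, a Rayleigh
    quotient at least eta on W becomes one at least tau on q(A)W
    ([krylov_filter_bound]).

    Let a = lambda_s and b = lambda_(t+1), and let W be orthogonal to
    x_(s+1), ..., x_t, so that only eigenvalues >= a or <= b matter.  If
    lambda_n < b, take for q the Chebyshev polynomial transplanted to
    [lambda_n, b]: there q^2 is at most 1, while q^2 >= F := q(a)^2 on
    [a, +oo).  On the two
    half-lines the condition above compares affine functions of lambda; choosing
    tau and kappa so that it is an equality at lambda = a with q^2 = F and at
    lambda = b with q^2 = 1 gives precisely
      (a - tau) / (tau - b) = F^-1 (a - eta) / (eta - b),
    and the ratio on the left decreases in tau ([lanczos_cluster_bound]).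

    Part (a) uses s = t - p + i and W inside the part of the iterate orthogonal
    to x_(s+1), ..., x_t, which has dimension at least p - (p - i); part (b)
    uses s = t, for which the orthogonality condition is empty, and the span of
    the first i Ritz vectors of the iterate. *)

(** * Chebyshev polynomials *)

Section Chebyshev.
Variable R : realType.
Implicit Types (x y : R) (k : nat).

Local Notation T k x := ((chebyshevT R k).[x]).

Lemma chebyshevSS k x : T k.+2 x = 2 * x * T k.+1 x - T k x.
Proof. by rewrite [chebyshevT R k.+2]/= !hornerE. Qed.

Lemma size_chebyshevT k : (size (chebyshevT R k) <= k.+1)%N.
Proof.
suff /andP[] : (size (chebyshevT R k) <= k.+1)%N &&
               (size (chebyshevT R k.+1) <= k.+2)%N by [].
elim: k => [|k /andP[IH0 IH1]]; first by rewrite /= size_polyC oner_eq0 size_polyX.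
rewrite IH1 [chebyshevT R k.+2]/= -/(chebyshevT R k.+1) (leq_trans (size_polyD _ _)) //.
rewrite geq_max size_polyN (leq_trans IH0) ?andbT; last by rewrite ltnW.
rewrite -mulrA mul_polyC (leq_trans (size_scale_leq _ _)) //.
by rewrite mulrC (leq_trans (size_polyMleq _ _)) // size_polyX addn2.
Qed.

(** The left-hand side is an invariant of the three-term recurrence.  With
    x = cos u it is the Pythagorean identity for the angle u; in this form it
    bounds T_k on [-1, 1] without trigonometry. *)
Lemma chebyshevT_pell k x :
  T k.+1 x ^+ 2 - 2 * x * T k.+1 x * T k x + T k x ^+ 2 = 1 - x ^+ 2.
Proof.
elim: k => [|k IHk]; first by rewrite /= !hornerE; ring.
by rewrite -IHk chebyshevSS; ring.
Qed.

Lemma chebyshevT_sqr_le1 k x : -1 <= x <= 1 -> T k x ^+ 2 <= 1.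
Proof.
move=> /andP[xge xle]; have : 0 <= 1 - x ^+ 2 by nra.
have pellE j : (T j.+1 x - x * T j x) ^+ 2 = (1 - x ^+ 2) * (1 - T j x ^+ 2).
  by have := chebyshevT_pell j x; lra.
rewrite le_eqVlt => /orP[/eqP x1|x_lt].
  (* at x = 1 or x = -1 the identity degenerates to T_(j+1) = x T_j *)
  elim: k => [|k IHk]; first by rewrite /= hornerE; lra.
  have := pellE k; rewrite -x1 mul0r => /eqP; rewrite sqrf_eq0 subr_eq0 => /eqP->.
  by rewrite exprMn; nra.
by rewrite -subr_ge0 -(pmulr_rge0 _ x_lt) -pellE sqr_ge0.
Qed.

(** The induction carries the increments T_(k+1) - T_k along, since
    T_(k+2) - T_(k+1) = 2 (x - 1) T_(k+1) + (T_(k+1) - T_k) is a sum of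
    nonnegative nondecreasing functions on [1, +oo). *)
Lemma chebyshevT_mono k x y : 1 <= x -> x <= y -> 1 <= T k x /\ T k x <= T k y.
Proof.
move=> x1 xy.
suff [h1 h2 _ _] : [/\ 1 <= T k x, T k x <= T k y,
    0 <= T k.+1 x - T k x & T k.+1 x - T k x <= T k.+1 y - T k y] by [].
elim: k => [|k [IH1 IH2 IH3 IH4]]; first by rewrite /= !hornerE; split; lra.
have Tx_ge1 : 1 <= T k.+1 x by lra.
have step_ge0 : 0 <= (x - 1) * T k.+1 x by rewrite mulr_ge0 //; lra.
have step_le : (x - 1) * T k.+1 x <= (y - 1) * T k.+1 y by apply: ler_pM; lra.
by rewrite !chebyshevSS; split; lra.
Qed.

End Chebyshev.

(** * From a filter gain to a bound on ratios *)

Section RationalBound.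
Variables (R : realFieldType) (F a b eta : R).

(* tau = filter_level and kappa = filter_scale, with common denominator D,
   solve F (a - tau) = kappa (a - eta) and b - tau = kappa (b - eta). *)
Let D := F * (eta - b) + (a - eta).
Definition filter_level := (a * F * (eta - b) + b * (a - eta)) / D.
Definition filter_scale := F * (a - b) / D.

Let D_gt0 : 1 <= F -> b < eta -> eta < a -> 0 < D.
Proof. by move=> *; rewrite addr_gt0 ?mulr_gt0 //; lra. Qed.

Let ab_le_D : 1 <= F -> b < eta -> a - b <= D.
Proof.
move=> F1 b_eta; have : 0 <= (F - 1) * (eta - b) by rewrite mulr_ge0 //; lra.
by rewrite /D; lra.
Qed.

Let D_le_Fab : 1 <= F -> eta <= a -> D <= F * (a - b).
Proof.
move=> F1 eta_a; have : 0 <= (F - 1) * (a - eta) by rewrite mulr_ge0 //; lra.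
by rewrite /D; lra.
Qed.

Lemma filter_scale_ge0 :
  1 <= F -> b < eta -> eta < a -> 0 <= filter_scale.
Proof.
move=> F1 b_eta eta_a; have D0 := D_gt0 F1 b_eta eta_a.
by rewrite divr_ge0 ?(ltW D0) // mulr_ge0 //; lra.
Qed.

(** Replacing f by F only decreases the right-hand side; the remaining affine
    inequality is an equality at lam = a, and the slopes compare because
    filter_scale <= F. *)
Lemma filter_dominates_above lam f :
  1 <= F -> b < eta -> eta < a ->
  a <= lam -> F <= f -> filter_scale * (lam - eta) <= f * (lam - filter_level).
Proof.
move=> F1 b_eta eta_a; have D0 := D_gt0 F1 b_eta eta_a.
move=> a_lam Ff; rewrite -(ler_pM2l D0).
have -> : D * (filter_scale * (lam - eta)) = F * (a - b) * (lam - eta).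
  by rewrite /filter_scale; field; rewrite gt_eqF.
have -> : D * (f * (lam - filter_level)) =
    f * (D * (lam - a) + (a - eta) * (a - b)).
  by rewrite /filter_level /D; field; rewrite gt_eqF.
apply: le_trans (ler_wpM2r _ Ff); last first.
  by rewrite addr_ge0 ?mulr_ge0 ?(ltW D0) //; lra.
rewrite -mulrA ler_wpM2l //; first lra.
have : (a - b) * (lam - a) <= D * (lam - a).
  by rewrite ler_wpM2r ?subr_ge0 //; have := ab_le_D F1 b_eta; lra.
lra.
Qed.

(** Here lam - filter_level is negative, so f may be replaced by 1; the affine
    inequality is an equality at lam = b, and filter_scale >= 1. *)
Lemma filter_dominates_below lam f :
  1 <= F -> b < eta -> eta < a ->
  lam <= b -> f <= 1 -> filter_scale * (lam - eta) <= f * (lam - filter_level).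
Proof.
move=> F1 b_eta eta_a; have D0 := D_gt0 F1 b_eta eta_a.
move=> lam_b f1; rewrite -(ler_pM2l D0).
have -> : D * (filter_scale * (lam - eta)) = F * (a - b) * (lam - eta).
  by rewrite /filter_scale; field; rewrite gt_eqF.
have -> : D * (f * (lam - filter_level)) =
    f * (D * (lam - b) - F * (eta - b) * (a - b)).
  by rewrite /filter_level /D; field; rewrite gt_eqF.
have neg : D * (lam - b) - F * (eta - b) * (a - b) <= 0.
  by rewrite subr_le0 (@le_trans _ _ 0) ?mulr_ge0_le0 ?mulr_ge0 ?(ltW D0) //; lra.
apply: le_trans (ler_wnM2r neg f1); rewrite mul1r.
have : (F * (a - b) - D) * (lam - b) <= 0.
  by rewrite mulr_ge0_le0 ?subr_le0 // subr_ge0 D_le_Fab // ltW.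
by rewrite /D; lra.
Qed.

(** With filter_level itself for psi the second inequality is an equality; after
    clearing denominators it is linear in psi. *)
Lemma ratio_bound psi :
  1 <= F -> b < eta -> eta < a ->
  filter_level <= psi -> psi < a -> b < psi ->
  0 < (a - psi) / (psi - b) /\
  (a - psi) / (psi - b) <= F^-1 * ((a - eta) / (eta - b)).
Proof.
move=> F1 b_eta eta_a; have D0 := D_gt0 F1 b_eta eta_a.
rewrite ler_pdivrMr // => level_psi psi_a b_psi.
split; first by rewrite divr_gt0 // subr_gt0.
rewrite ler_pdivrMr ?subr_gt0 //.
rewrite -[leRHS]mulrA -(ler_pM2l (_ : 0 < F * (eta - b))); last by rewrite mulr_gt0 //; lra.
have -> : F * (eta - b) * (F^-1 * ((a - eta) / (eta - b) * (psi - b))) =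
    (a - eta) * (psi - b) by field; rewrite !gt_eqF //; lra.
by rewrite /D in level_psi; lra.
Qed.

End RationalBound.

(** * Inner products and orthonormal families *)

Lemma big_succ_ord (T : Type) (idx : T) (op : T -> T -> T) m (F : nat -> T) :
  \big[op/idx]_(1 <= j < m.+1) F j = \big[op/idx]_(j < m) F j.+1.
Proof. by rewrite big_add1 big_mkord. Qed.

Section Inner.
Variables (R : realType) (n : nat).
Implicit Types (u v w : 'cV[R[i]]_n) (A : 'M[R[i]]_n).

Lemma innerE u v : inner u v = \sum_j (u j 0)^*%R * v j 0.
Proof. by rewrite /inner mxE; apply: eq_bigr => j _; rewrite !mxE. Qed.

Lemma innerC u v : inner v u = (inner u v)^*%R.
Proof.
rewrite !innerE rmorph_sum; apply: eq_bigr => j _.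
by rewrite rmorphM /= conjCK mulrC.
Qed.

Lemma innerZr c u v : inner u (c *: v) = c * inner u v.
Proof. by rewrite /inner -scalemxAr mxE. Qed.

Lemma innerZl c u v : inner (c *: u) v = c^*%R * inner u v.
Proof. by rewrite innerC innerZr rmorphM /= -innerC. Qed.

Lemma inner_sumr (I : Type) (r : seq I) (P : pred I) u (v : I -> 'cV_n) :
  inner u (\sum_(j <- r | P j) v j) = \sum_(j <- r | P j) inner u (v j).
Proof. by rewrite /inner mulmx_sumr summxE. Qed.

Lemma inner_suml (I : Type) (r : seq I) (P : pred I) (u : I -> 'cV_n) v :
  inner (\sum_(j <- r | P j) u j) v = \sum_(j <- r | P j) inner (u j) v.
Proof.
by rewrite innerC inner_sumr rmorph_sum; apply: eq_bigr => j _ /=; rewrite -innerC.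
Qed.

Lemma inner_hermitian A u v : A \is hermsymmx -> inner u (A *m v) = inner (A *m u) v.
Proof.
move=> /is_hermitianmxP hA; rewrite expr0 scale1r in hA.
by rewrite /inner trmx_mul map_mxM -hA mulmxA.
Qed.

Lemma inner_linear_comb m (x : nat -> 'cV[R[i]]_n) (c : nat -> R[i]) j :
    orthonormal_family m x -> (1 <= j <= m)%N ->
  inner (x j) (\sum_(1 <= l < m.+1) c l *: x l) = c j.
Proof.
move=> xo hj; rewrite inner_sumr.
rewrite (bigD1_seq j) ?mem_index_iota ?iota_uniq //= innerZr xo // eqxx mulr1.
rewrite big_seq_cond big1 ?addr0 // => l; rewrite mem_index_iota => /andP[hl nlj].
by rewrite innerZr xo // eq_sym (negPf nlj) mulr0.
Qed.

Lemma orthonormal_free m (x : nat -> 'cV[R[i]]_n) :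
  orthonormal_family m x -> free [tuple x j.+1 | j < m].
Proof.
move=> xo; apply/freeP => c hc j.
(* coefficients indexed by 'I_m, moved to the indices 1, ..., m *)
pose c' l := oapp c 0 (insub l.-1).
have /(congr1 (inner (x j.+1))) := hc.
have -> : \sum_(l < m) c l *: [tuple x j.+1 | j < m]`_l =
    \sum_(1 <= l < m.+1) c' l *: x l.
  rewrite big_succ_ord; apply: eq_bigr => l _.
  by rewrite -tnth_nth tnth_mktuple /c' /= valK.
rewrite inner_linear_comb ?ltn_ord // /c' /= valK /= => ->.
by rewrite /inner mulmx0 mxE.
Qed.

Lemma orthonormal_leq_dim m (x : nat -> 'cV[R[i]]_n) (V : {vspace 'cV[R[i]]_n}) :
    orthonormal_family m x -> (forall j, (1 <= j <= m)%N -> x j \in V) ->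
  (m <= \dim V)%N.
Proof.
move=> /orthonormal_free xfree xV.
rewrite -[X in (X <= _)%N](size_tuple [tuple x j.+1 | j < m]).
rewrite -(eqP xfree); apply/dimvS/span_subvP => _ /mapP[j _ ->].
by apply: xV; rewrite ltn_ord.
Qed.

Lemma orthonormal_expansion m (x : nat -> 'cV[R[i]]_n) (V : {vspace 'cV[R[i]]_n}) w :
    orthonormal_family m x -> (forall j, (1 <= j <= m)%N -> x j \in V) ->
    (\dim V <= m)%N -> w \in V ->
  w = \sum_(1 <= j < m.+1) inner (x j) w *: x j.
Proof.
move=> xo xV dV wV.
have xbasis : basis_of V [tuple x j.+1 | j < m].
  rewrite basisEfree orthonormal_free // size_tuple dV andbT.
  by apply/span_subvP => _ /mapP[j _ ->]; apply: xV; rewrite ltn_ord.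
have [c wE] : exists c : nat -> R[i], w = \sum_(1 <= j < m.+1) c j *: x j.
  exists (fun l => oapp (coord [tuple x j.+1 | j < m] ^~ w) 0 (insub l.-1)).
  rewrite {1}(coord_basis xbasis wV) big_succ_ord.
  by apply: eq_bigr => j _; rewrite -tnth_nth tnth_mktuple /= valK.
rewrite {1}wE big_nat [RHS]big_nat; apply: eq_bigr => j hj.
by rewrite {1}wE inner_linear_comb.
Qed.

Lemma dim_sum_lines r m (x : nat -> 'cV[R[i]]_n) :
  (\dim (\sum_(r <= j < m) <[x j]>)%VS <= m - r)%N.
Proof.
rewrite -[X in (_ <= X)%N](size_iota r) /index_iota.
elim: (iota _ _) => [|j s IHs] /=; first by rewrite big_nil dimv0.
rewrite big_cons; apply: leq_trans (dimv_add_leqif _ _) _.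
by apply: (@leq_add _ _ 1) => //; rewrite dim_vline leq_b1.
Qed.

Lemma mem_sum_lines r m (x : nat -> 'cV[R[i]]_n) j :
  (r <= j < m)%N -> x j \in (\sum_(r <= l < m) <[x l]>)%VS.
Proof.
rewrite -mem_index_iota; elim: (index_iota _ _) => //= l s IHs.
rewrite inE big_cons => /orP[/eqP-> | /IHs js].
  by apply: (subvP (addvSl _ _)); apply: memv_line.
exact: (subvP (addvSr _ _)).
Qed.

Lemma sum_lines_sub r m (x : nat -> 'cV[R[i]]_n) (V : {vspace 'cV[R[i]]_n}) :
    (forall j, (r <= j < m)%N -> x j \in V) ->
  (\sum_(r <= j < m) <[x j]> <= V)%VS.
Proof.
move=> xV; rewrite big_nat; elim/big_rec: _ => [|j U hj UV]; first exact: sub0v.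
by rewrite subv_add -memvE xV.
Qed.

(** Each vector of a basis of S imposes one linear equation on W. *)
Lemma dim_orth_compl_cap (S W : {vspace 'cV[R[i]]_n}) :
  (\dim W <= \dim (orth_compl S :&: W) + \dim S)%N.
Proof.
rewrite /orth_compl -[X in (_ + X)%N](size_tuple (vbasis S)).
elim: (tval (vbasis S)) => [|u s IHs] /=.
  by rewrite big_nil capfv addn0.
rewrite big_cons -capvA capvC addnS -addSn.
apply: (leq_trans IHs); rewrite leq_add2r.
set f := linfun _; set U := (_ :&: W)%VS.
have fU : (\dim (f @: U) <= 1)%N.
  by apply: leq_trans (dimvS (subvf _)) _; rewrite dimvf.
by rewrite -(limg_ker_dim f U) -[X in (_ <= X)%N]addn1 leq_add2l.
Qed.

End Inner.

(** * Orthonormal Ritz vectors *)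

Section Spectral.
Variable R : realType.

Lemma char_poly_similar (C : comNzRingType) d (B D P : 'M[C]_d) :
  B *m P = 1%:M -> char_poly (B *m D *m P) = char_poly D.
Proof.
move=> BP1; rewrite /char_poly.
have -> : char_poly_mx (B *m D *m P) =
    map_mx polyC B *m char_poly_mx D *m map_mx polyC P.
  rewrite /char_poly_mx mulmxBr mulmxBl !map_mxM; congr (_ - _).
  by rewrite mul_mx_scalar -scalemxAl -map_mxM BP1 map_mx1 scalemx1.
by rewrite !det_mulmx mulrAC -det_mulmx -map_mxM BP1 map_mx1 det1 mul1r.
Qed.

(** The spectral theorem yields eigenvectors in some order; comparing the roots
    of the characteristic polynomial gives a permutation that sorts them as the
    prescribed mu. *)
Lemma hermitian_eigenbasis d (M : 'M[R[i]]_d) (mu : nat -> R) :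
    M \is hermsymmx -> eigenvalues_decr M mu ->
  exists2 g : nat -> 'cV[R[i]]_d, orthonormal_family d g &
    forall j, (1 <= j <= d)%N -> M *m g j = (mu j)%:C *: g j.
Proof.
move=> hM [charM _]; pose P := spectralmx M; pose D := spectral_diag M.
have Punit : P *m P^t* = 1%:M by apply/unitarymxP/spectral_unitarymx.
have Punit' : P^t* *m P = 1%:M by apply: mulmx1C.
have ME : M = P^t* *m diag_mx D *m P.
  rewrite -(invmx_unitary (spectral_unitarymx M)).
  exact/orthomx_spectralP/hermitian_normalmx.
have /prod_XsubC_eq/tuple_permP[s sE] :
    \prod_(z <- [seq D 0 j | j <- enum 'I_d]) ('X - z%:P) =
    \prod_(z <- [tuple (mu j.+1)%:C | j < d]) ('X - z%:P).
  rewrite big_map big_enum big_tuple /=.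
  rewrite [RHS](eq_bigr (fun j : 'I_d => 'X - (mu j.+1)%:C%:P)); last first.
    by move=> j _; rewrite tnth_mktuple.
  have := charM; rewrite ME char_poly_similar // big_succ_ord => <-.
  by rewrite char_poly_trig ?diag_mx_is_trig //; apply: eq_bigr => j _; rewrite mxE eqxx.
have DE j : D 0 j = (mu (s j).+1)%:C.
  have /(congr1 (fun z => nth 0 z j)) := sE.
  rewrite -tnth_nth tnth_mktuple tnth_mktuple (nth_map j) ?size_enum_ord //.
  by rewrite nth_ord_enum.
pose g l := oapp (fun j => col ((s^-1)%g j) (P^t*)) 0 (insub l.-1).
have gE (j : 'I_d) : g j.+1 = col ((s^-1)%g j) (P^t*) by rewrite /g /= valK.
have ordE l : (1 <= l <= d)%N -> exists j : 'I_d, l = j.+1.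
  by case: l => // l ld; exists (Ordinal ld).
exists g => [j' l' /ordE[j ->] /ordE[l ->] | l /ordE[j ->]].
  have := congr1 (fun Q : 'M_d => Q ((s^-1)%g j) ((s^-1)%g l)) Punit.
  rewrite /inner !gE !mxE eqSS (inj_eq val_inj) (inj_eq perm_inj) => <-.
  by apply: eq_bigr => r _; rewrite !mxE conjCK.
have MP : M *m P^t* = P^t* *m diag_mx D by rewrite {1}ME -(mulmxA _ P) Punit mulmx1.
rewrite gE {1}colE mulmxA MP -colE; apply/colP => r.
by rewrite mul_mx_diag !mxE DE permKV mulrC.
Qed.

End Spectral.

Section RitzSystem.
Variables (R : realType) (n : nat) (A : 'M[R[i]]_n).
Hypothesis hA : A \is hermsymmx.
Implicit Types (V W : {vspace 'cV[R[i]]_n}) (eta : nat -> R).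

Lemma inner_mulmxl m d (U : 'M[R[i]]_(m, d)) (u : 'cV_d) (v : 'cV_m) :
  inner (U *m u) v = inner u (U^t* *m v).
Proof. by rewrite /inner trmx_mul map_mxM mulmxA. Qed.

Definition nonincreasing_upto d eta :=
  forall j l : nat, (1 <= j)%N -> (j <= l)%N -> (l <= d)%N -> eta l <= eta j.

(** The last clause is the Galerkin condition: the residual of (eta j, y j) is
    orthogonal to V.  It does not refer to a basis matrix of V, and it
    survives passing to a subspace that still contains the vectors.  For
    V = fullv it says that the y j are eigenvectors of A. *)
Definition ritz_system V m eta (y : nat -> 'cV[R[i]]_n) : Prop :=
  [/\ orthonormal_family m y, forall j, (1 <= j <= m)%N -> y j \in V &
      forall j u, (1 <= j <= m)%N -> u \in V ->
        inner u (A *m y j) = (eta j)%:C * inner u (y j)].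

(** For w != 0, this is nonnegative exactly when the Rayleigh quotient of w is at
    least tau. *)
Definition rayleigh_gap (tau : R) (w : 'cV[R[i]]_n) : R[i] :=
  inner w (A *m w) - tau%:C * inner w w.

Lemma ritz_basis_galerkin V d (U : 'M[R[i]]_(n, d)) (g : 'cV_d) (e : R) u :
    orthonormal_basis_mx U V -> (U^t* *m A *m U) *m g = e%:C *: g -> u \in V ->
  inner u (A *m (U *m g)) = e%:C * inner u (U *m g).
Proof.
move=> [UU <-] Ug /mem_mximg[v _ ->].
by rewrite !inner_mulmxl !mulmxA Ug UU mul1mx innerZr.
Qed.

Lemma mem_basis_mx V d (U : 'M[R[i]]_(n, d)) (g : 'cV_d) :
  orthonormal_basis_mx U V -> U *m g \in V.
Proof. by case=> _ <-; apply/mem_mximg; exists g; rewrite ?memvf. Qed.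

Lemma ritz_values_system V eta :
    ritz_values A V eta ->
  nonincreasing_upto (\dim V) eta /\ exists y, ritz_system V (\dim V) eta y.
Proof.
case=> U hU heta; split; first by case: heta.
have hM : U^t* *m A *m U \is hermsymmx.
  apply/is_hermitianmxP; rewrite expr0 scale1r !trmx_mul !map_mxM trmxCK mulmxA.
  by have /is_hermitianmxP := hA; rewrite expr0 scale1r => <-.
have [g go gE] := hermitian_eigenbasis hM heta.
exists (fun j => U *m g j); split=> [j l hj hl | j hj | j u hj uV].
- by rewrite inner_mulmxl mulmxA hU.1 mul1mx go.
- exact: mem_basis_mx hU.
- exact: ritz_basis_galerkin hU (gE _ hj) uV.
Qed.

Lemma ritz_systemS V W m m' eta y :
    ritz_system V m eta y -> (W <= V)%VS -> (m' <= m)%N ->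
    (forall j, (1 <= j <= m')%N -> y j \in W) ->
  ritz_system W m' eta y.
Proof.
move=> [yo yV yE] /subvP WV m'm yW.
have le_m j : (1 <= j <= m')%N -> (1 <= j <= m)%N.
  by move=> /andP[-> /leq_trans->].
split=> // [j l /le_m hj /le_m hl | j u /le_m hj /WV]; [exact: yo | exact: yE].
Qed.

(** This makes the span of the first few Ritz vectors a trial subspace for the
    min-max principle: its smallest Ritz value is known. *)
Lemma ritz_system_lines V m m' eta y :
    ritz_system V m eta y -> (m' <= m)%N ->
  ritz_system (\sum_(1 <= j < m'.+1) <[y j]>) m' eta y.
Proof.
move=> hy m'm; apply: (ritz_systemS hy) => // [|j hj]; last by apply: mem_sum_lines.
case: hy => _ yV _; apply: sum_lines_sub => j /andP[j1 jm'].
by apply: yV; rewrite j1 (leq_trans _ m'm).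
Qed.

Lemma inner_self_expansion V m eta y w :
    ritz_system V m eta y -> (\dim V <= m)%N -> w \in V ->
  inner w w = \sum_(1 <= j < m.+1) `|inner (y j) w| ^+ 2.
Proof.
move=> [yo yV _] dV wV; rewrite {1}(orthonormal_expansion yo yV dV wV).
by rewrite inner_suml; apply: eq_bigr => j _; rewrite innerZl mulrC -normCK.
Qed.

(** By the Galerkin condition, the compression of A to V is diagonal in the
    basis y. *)
Lemma rayleigh_gap_expansion V m eta y tau w :
    ritz_system V m eta y -> (\dim V <= m)%N -> w \in V ->
  rayleigh_gap tau w =
    \sum_(1 <= j < m.+1) (eta j - tau)%:C * `|inner (y j) w| ^+ 2.
Proof.
move=> hy dV wV; rewrite /rayleigh_gap (inner_self_expansion hy) //.
case: hy => yo yV yE; rewrite {1}(orthonormal_expansion yo yV dV wV).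
rewrite inner_suml mulr_sumr -sumrB !big_nat; apply: eq_bigr => j hj.
have cE : inner (y j) (A *m w) = (eta j)%:C * inner (y j) w.
  rewrite inner_hermitian // innerC yE // rmorphM /= -innerC.
  by rewrite conj_Creal ?complex_real.
by rewrite innerZl cE rmorphB /= mulrBl normCK mulrCA [_^*%R * _]mulrC.
Qed.

(** * The min-max principle *)

Lemma ritz_gap_ge0 V m eta y w :
    ritz_system V m eta y -> (\dim V <= m)%N -> nonincreasing_upto m eta ->
  w \in V -> 0 <= rayleigh_gap (eta m) w.
Proof.
move=> hy dV decr wV; rewrite (rayleigh_gap_expansion _ hy dV wV) big_nat.
apply: sumr_ge0 => j /andP[j1 jm]; rewrite mulr_ge0 ?exprn_ge0 // ler0c subr_ge0.
exact: decr.
Qed.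

(** The expansion of the gap has no positive term, so all its terms vanish, and
    the factors eta j - tau of the possibly nonzero coordinates do not. *)
Lemma gap_ge0_eq0 V m eta y tau w :
    ritz_system V m eta y -> (\dim V <= m)%N -> w \in V ->
    0 <= rayleigh_gap tau w ->
    (forall j, (1 <= j <= m)%N -> inner (y j) w = 0 \/ eta j < tau) ->
  w = 0.
Proof.
move=> hy dV wV; rewrite (rayleigh_gap_expansion _ hy dV wV) => gap_ge0 small.
have F_ge0 j : (1 <= j < m.+1)%N ->
    0 <= (tau - eta j)%:C * `|inner (y j) w| ^+ 2.
  move=> /small[->|lt_j]; first by rewrite normr0 expr0n mulr0.
  by rewrite mulr_ge0 ?exprn_ge0 // ler0c subr_ge0 ltW.
have /eqP sum0 : \sum_(1 <= j < m.+1) (tau - eta j)%:C * `|inner (y j) w| ^+ 2 = 0.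
  apply/le_anti/andP; split; last by rewrite big_nat sumr_ge0.
  rewrite -oppr_ge0 -sumrN; apply: le_trans gap_ge0 _.
  by rewrite le_eqVlt -subr_eq0 -sumrB big1 ?eqxx // => j _;
    rewrite -mulNr -rmorphN opprB subrr.
rewrite big_nat psumr_eq0 // in sum0.
case: hy => yo yV _; rewrite (orthonormal_expansion yo yV dV wV) big_nat.
apply: big1 => j hj; case: (small j hj) => [-> | lt_j]; first exact: scale0r.
move/allP: sum0 => /(_ j); rewrite mem_index_iota hj => /(_ isT).
rewrite mulf_eq0 expf_eq0 normr_eq0 (inj_eq (@complexI R)) subr_eq0 gt_eqF //=.
by move=> /eqP->; rewrite scale0r.
Qed.

(** Courant-Fischer: if eta i < tau, then a vector w != 0 of W orthogonal to the
    first i - 1 Ritz vectors exists by dimension count and has only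
    coordinates with eta j < tau, which contradicts the gap condition. *)
Lemma ritz_minmax V W m eta y tau i :
    ritz_system V m eta y -> (\dim V <= m)%N -> nonincreasing_upto m eta ->
    (W <= V)%VS -> (1 <= i <= \dim W)%N ->
    (forall w, w \in W -> 0 <= rayleigh_gap tau w) ->
  tau <= eta i.
Proof.
move=> hy dV decr WV /andP[i1 iW] gapW; rewrite leNgt; apply/negP => lt_i.
pose S := (\sum_(1 <= j < i) <[y j]>)%VS; pose T := (orth_compl S :&: W)%VS.
have dT : (0 < \dim T)%N.
  rewrite -(ltn_add2r (\dim S)) add0n.
  apply: leq_trans (leq_trans iW (dim_orth_compl_cap S W)).
  by apply: leq_ltn_trans (dim_sum_lines _ _ _) _; rewrite subn1 prednK.
have : vpick T != 0 by rewrite vpick0 -dimv_eq0 -lt0n.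
have : vpick T \in T by apply: memv_pick.
rewrite memv_cap => /andP[/mem_orth_compl wS wW] /eqP; apply.
apply: (gap_ge0_eq0 hy dV (subvP WV _ wW) (gapW _ wW)) => j /andP[j1 jm].
have [ji|ij] := ltnP j i; first by left; apply/wS/mem_sum_lines; rewrite j1.
by right; apply: le_lt_trans lt_i; apply: decr.
Qed.

(** The min-max principle is applied twice: in the Krylov subspace K, to bound
    its i-th Ritz value theta i by W, and in the new iterate Y', to compare
    psi' i with theta i through the span of the first i selected Ritz
    vectors. *)
Lemma lanczos_ritz_lower p k i tau (Y Y' W : {vspace 'cV[R[i]]_n}) psi' :
    lanczos_step A p k Y Y' -> ritz_values A Y' psi' ->
    (1 <= i <= p)%N -> (W <= block_krylov A Y k)%VS -> (i <= \dim W)%N ->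
    (forall w, w \in W -> 0 <= rayleigh_gap tau w) ->
  tau <= psi' i.
Proof.
move=> [theta [y [htheta yo yritz Y'E]]] hpsi' /andP[i1 ip] WK iW gapW.
set K := block_krylov A Y k in htheta yritz WK.
(* z is a full Ritz basis of K; the vectors y may lie outside it when Ritz
   values coincide *)
have [decr [z hz]] := ritz_values_system htheta.
have [decr' [z' hz']] := ritz_values_system hpsi'.
have hy : ritz_system K p theta y.
  split=> // [j /yritz[U [g [hU _ _ ->]]] | j u /yritz[U [g [hU _ Ug ->]]] uK].
    exact: mem_basis_mx hU.
  exact: ritz_basis_galerkin hU Ug uK.
have iK : (i <= \dim K)%N by apply: leq_trans iW (dimvS WK).
apply: (@le_trans _ _ (theta i)).
  by apply: (ritz_minmax hz _ decr WK _ gapW); rewrite ?i1.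
pose W1 := (\sum_(1 <= j < i.+1) <[y j]>)%VS.
have hW1 : ritz_system W1 i theta y by apply: ritz_system_lines hy ip.
apply: (ritz_minmax (W := W1) hz') => // [||w wW1].
- rewrite Y'E; apply: sum_lines_sub => j /andP[j1 ji]; apply: mem_sum_lines.
  by rewrite j1 (leq_trans ji).
- by case: hW1 => yo1 yW1 _; rewrite i1 (orthonormal_leq_dim yo1 yW1).
apply: (ritz_gap_ge0 hW1) => //.
  by apply: leq_trans (dim_sum_lines _ _ _) _; rewrite subn1.
by move=> j l j1 jl li; apply: decr; rewrite // (leq_trans li).
Qed.

(** * Polynomial filters *)

Definition poly_mx (k : nat) (q : {poly R}) : 'M[R[i]]_n :=
  \sum_(m < k.+1) (q`_m)%:C *: A ^+ m.

Lemma poly_mx_mem_krylov k q (Y : {vspace 'cV[R[i]]_n}) w :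
  w \in Y -> poly_mx k q *m w \in block_krylov A Y k.
Proof.
move=> wY; rewrite mulmx_suml rpred_sum // => m _.
rewrite -scalemxAl rpredZ //; apply: (subvP (sumv_sup m isT (subvv _))).
by apply/mem_mximg; exists w.
Qed.

(** A Hermitian A acts on the left argument, where x is an eigenvector with a
    real eigenvalue. *)
Lemma inner_poly_mx k (q : {poly R}) (x : 'cV[R[i]]_n) (e : R) w :
    A *m x = e%:C *: x -> (size q <= k.+1)%N ->
  inner x (poly_mx k q *m w) = (q.[e])%:C * inner x w.
Proof.
move=> xE sq; rewrite mulmx_suml inner_sumr (horner_coef_wide _ sq).
rewrite rmorph_sum mulr_suml; apply: eq_bigr => m _ /=.
rewrite -scalemxAl innerZr rmorphM rmorphXn -mulrA; congr (_ * _).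
elim: (m : nat) => [|r IHr]; first by rewrite !expr0 mul1mx mul1r.
rewrite !exprS -mulmxE -mulmxA inner_hermitian // xE innerZl IHr.
by rewrite conj_Creal ?complex_real // mulrA.
Qed.

Section Eigenbasis.
Variables (lambda : nat -> R) (x : nat -> 'cV[R[i]]_n).
Hypotheses (xo : orthonormal_family n x)
  (xE : forall j, (1 <= j <= n)%N -> A *m x j = (lambda j)%:C *: x j).

Lemma eigenbasis_system : ritz_system fullv n lambda x.
Proof.
by split=> // [j _ | j u hj _]; [rewrite memvf | rewrite xE // innerZr].
Qed.

Let dim_full : (\dim {:'cV[R[i]]_n} <= n)%N.
Proof. by rewrite dimvf /dim /= muln1. Qed.

(** [q.[lambda j] != 0] for j <= s makes q(A) injective on W, so that q(A)W
    keeps the dimension: a vector of W killed by q(A) has only coordinates with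
    lambda j < eta left, which the gap condition excludes. *)
Lemma krylov_filter_bound p k i s t (tau eta kappa : R) (q : {poly R})
    (Y Y' W : {vspace 'cV[R[i]]_n}) psi' :
    lanczos_step A p k Y Y' -> ritz_values A Y' psi' -> (1 <= i <= p)%N ->
    (W <= Y)%VS -> (i <= \dim W)%N ->
    (forall w j, w \in W -> (s < j <= t)%N -> inner (x j) w = 0) ->
    (forall w, w \in W -> 0 <= rayleigh_gap eta w) ->
    (forall j, (t < j <= n)%N -> lambda j < eta) ->
    (size q <= k.+1)%N -> 0 <= kappa ->
    (forall j, (1 <= j <= s)%N -> q.[lambda j] != 0) ->
    (forall j, (1 <= j <= n)%N -> (j <= s)%N \/ (t < j)%N ->
       kappa * (lambda j - eta) <= q.[lambda j] ^+ 2 * (lambda j - tau)) ->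
  tau <= psi' i.
Proof.
move=> hstep hpsi' hi WY iW Wx gapW tail_lt sq kappa_ge0 q_neq0 q_dom.
pose Q := poly_mx k q.
have coefQ j w : (1 <= j <= n)%N ->
    inner (x j) (Q *m w) = (q.[lambda j])%:C * inner (x j) w.
  by move=> hj; apply: inner_poly_mx sq; apply: xE.
have Qinj : (W :&: lker (linfun (mulmx Q : 'cV_n -> 'cV_n)))%VS = 0%VS.
  apply/eqP; rewrite -subv0; apply/subvP => w; rewrite memv_cap memv_ker lfunE /=.
  move=> /andP[wW /eqP Qw0]; rewrite memv0; apply/eqP.
  apply: (gap_ge0_eq0 eigenbasis_system dim_full (memvf w) (gapW w wW)) => j hj.
  have [tj|jt] := ltnP t j; first by right; apply: tail_lt; case/andP: hj => _ ->; rewrite tj.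
  left; have [sj|js] := ltnP s j; first by apply: Wx; rewrite // sj.
  have := coefQ j w hj; rewrite Qw0 /inner mulmx0 mxE => /esym/eqP.
  rewrite mulf_eq0 (inj_eq (@complexI R)) (negPf (q_neq0 j _)) => [/eqP//|].
  by case/andP: hj => ->.
apply: (lanczos_ritz_lower hstep hpsi' hi (W := mximg Q W)).
- apply/subvP => _ /mem_mximg[w wW ->].
  by apply: poly_mx_mem_krylov; apply: (subvP WY).
- by rewrite /mximg limg_dim_eq.
- move=> _ /mem_mximg[w wW ->].
  have : 0 <= kappa%:C * rayleigh_gap eta w by rewrite mulr_ge0 ?ler0c ?gapW.
  rewrite !(rayleigh_gap_expansion _ eigenbasis_system dim_full (memvf _)).
  move/le_trans; apply; rewrite mulr_sumr big_nat [leRHS]big_nat.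
  apply: ler_sum => j hj; rewrite coefQ // normrM exprMn.
  have [/andP[sj jt]|far] := boolP (s < j <= t)%N.
    by rewrite (Wx w j wW) ?sj // normr0 expr0n !mulr0.
  rewrite [leLHS]mulrA [leRHS]mulrA ler_wpM2r ?exprn_ge0 // normc_def /= expr0n addr0 sqrtr_sqr.
  rewrite -!rmorphM -rmorphXn -rmorphM lecR real_normK ?num_real // [leRHS]mulrC.
  apply: q_dom => //; move: far; rewrite negb_and -leqNgt -ltnNge.
  by case/orP; [left | right].
Qed.

(** The constant filter q = 1 already shows eta <= psi' i, so that b < eta < a
    whenever psi' i < a.  If b = lambda n, the interval [lambda n, b] degenerates to
    a point and, for k > 0, the filter X - b annihilates all eigenvalues <= b:
    then psi' i >= a, in agreement with the factor 0. *)
Lemma lanczos_cluster_bound p k i s t (eta : R) (Y Y' W : {vspace 'cV[R[i]]_n}) psi' :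
    nonincreasing_upto n lambda ->
    lanczos_step A p k Y Y' -> ritz_values A Y' psi' -> (1 <= i <= p)%N ->
    (W <= Y)%VS -> (i <= \dim W)%N -> (1 <= s <= t)%N -> (t < n)%N ->
    (forall w j, w \in W -> (s < j <= t)%N -> inner (x j) w = 0) ->
    (forall w, w \in W -> 0 <= rayleigh_gap eta w) ->
    let a := lambda s in let b := lambda t.+1 in
    b < eta -> psi' i < a ->
  0 < (a - psi' i) / (psi' i - b) /\
  (a - psi' i) / (psi' i - b) <=
    chebyshev_factor k a b (lambda n) * ((a - eta) / (eta - b)).
Proof.
move=> decr hstep hpsi' hi WY iW /andP[s1 st] tn Wx gapW a b b_eta psi_a.
have above j : (1 <= j <= s)%N -> a <= lambda j.
  by move=> /andP[j1 js]; apply: decr => //; lia.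
have below j : (t < j <= n)%N -> lambda n <= lambda j <= b.
  by move=> /andP[tj jn]; rewrite !decr //; lia.
have tail_lt j : (t < j <= n)%N -> lambda j < eta.
  by move=> /below/andP[_ jb]; apply: le_lt_trans b_eta.
(* from here on, only the filter q and the constants tau and kappa vary *)
have filter := krylov_filter_bound (i := i) hstep hpsi' hi WY iW Wx gapW tail_lt.
have eta_psi : eta <= psi' i.
  apply: (filter eta 1 1) => // [|j _|j _ _]; rewrite ?size_polyC ?oner_eq0 //.
    by rewrite hornerC oner_eq0.
  by rewrite hornerC expr1n.
have eta_a : eta < a by apply: le_lt_trans psi_a.
have b_psi : b < psi' i by apply: lt_le_trans eta_psi.
have split_index j : (1 <= j <= n)%N -> (j <= s)%N \/ (t < j)%N ->
    a <= lambda j \/ lambda n <= lambda j <= b.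
  move=> /andP[j1 jn] [js|tj]; [left; apply: above | right; apply: below].
    by rewrite j1.
  by rewrite tj.
rewrite /chebyshev_factor; case: eqP => [b_eq|/eqP b_neq].
  case: k hstep filter => [|k] hstep filter /=.
    (* for k = 0 the only filter is constant, with gain F = 1 *)
    have level_le : filter_level 1 a b eta <= psi' i.
      by rewrite /filter_level ler_pdivrMr; nra.
    by have := ratio_bound (lexx 1) b_eta eta_a level_le psi_a b_psi; rewrite invr1.
  suff : a <= psi' i by rewrite leNgt psi_a.
  apply: (filter a 0 ('X - b%:P)) => // [|j hj|j hj far]; rewrite ?size_XsubC //.
    by rewrite hornerXsubC subr_eq0 gt_eqF // (lt_le_trans (lt_trans b_eta eta_a)) ?above.
  rewrite hornerXsubC mul0r.
  have [a_le|/andP[]] := split_index j hj far.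
    by rewrite mulr_ge0 ?sqr_ge0 ?subr_ge0.
  by rewrite -b_eq => b_le le_b; rewrite (le_anti (_ : lambda j <= b <= lambda j)) ?le_b ?subrr ?expr0n ?mul0r.
have c_b : lambda n < b.
  by rewrite lt_neqAle eq_sym b_neq /b decr.
(* L is the affine map that sends [lambda n, b] onto [-1, 1] *)
pose r := (2 / (b - lambda n)).
pose L : {poly R} := r *: 'X + (1 - r * b)%:P.
have LE z : L.[z] = 1 + 2 * ((z - b) / (b - lambda n)).
  by rewrite /L !(hornerD, hornerZ, hornerX, hornerC) /r; field; rewrite gt_eqF // subr_gt0.
have r_gt0 : 0 < r by rewrite divr_gt0 // subr_gt0.
have La : 1 <= L.[a].
  by rewrite LE lerDl mulr_ge0 // divr_ge0 // subr_ge0 ltW // (lt_trans b_eta).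
pose q := chebyshevT R k \Po L.
have qE z : q.[z] = (chebyshevT R k).[L.[z]] by rewrite horner_comp.
have q_above z : a <= z -> 1 <= q.[a] /\ q.[a] <= q.[z].
  move=> az; rewrite !qE; apply: chebyshevT_mono => //.
  by rewrite /L !(hornerD, hornerZ, hornerX, hornerC) lerD2r ler_pM2l.
have [qa1 _] := q_above a (lexx a).
have F1 : 1 <= q.[a] ^+ 2 by rewrite exprn_ege1.
rewrite -LE -qE; apply: ratio_bound => //.
apply: (filter _ (filter_scale (q.[a] ^+ 2) a b eta) q).
- apply: leq_trans (size_comp_poly_leq _ _) _; rewrite ltnS.
  have sL : (size L <= 2)%N.
    rewrite (leq_trans (size_polyD _ _)) // geq_max.
    by rewrite (leq_trans (size_scale_leq _ _)) ?size_polyX // size_polyC; case: (_ != 0).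
  have pred_le m r' : (m <= r'.+1 -> m.-1 <= r')%N by case: m.
  by have := leq_mul (pred_le _ _ (size_chebyshevT R k)) (pred_le _ _ sL); rewrite muln1.
- exact: filter_scale_ge0.
- by move=> j /above/q_above[_ qle]; rewrite gt_eqF //; lra.
- move=> j hj far; have [a_le|/andP[c_le le_b]] := split_index j hj far.
    apply: filter_dominates_above => //; have [_ qle] := q_above _ a_le.
    by rewrite ler_pXn2r // nnegrE; lra.
  apply: filter_dominates_below => //; rewrite qE chebyshevT_sqr_le1 // LE.
  have d_gt0 : 0 < b - lambda n by rewrite subr_gt0.
  have : -1 <= (lambda j - b) / (b - lambda n) by rewrite ler_pdivlMr //; lra.
  have : (lambda j - b) / (b - lambda n) <= 0 by rewrite ler_pdivrMr //; lra.
  by lra.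
Qed.

End Eigenbasis.
End RitzSystem.

(** * Convergence of the Ritz values in one outer step *)

Theorem theorem4p1 (R : realType) (n p k : nat) (A : 'M[R[i]]_n)
    (lambda : nat -> R) (Y : nat -> {vspace 'cV[R[i]]_n})
    (psi : nat -> nat -> R) (l i : nat)
    (hA : A \is hermsymmx)
    (hlambda : eigenvalues_decr A lambda)
    (hY : restarted_block_lanczos A p k Y)
    (hpsi : forall m : nat, ritz_values A (Y m) (psi m))
    (hi : (1 <= i <= p)%N) :
  (forall t : nat, (p <= t <= n - 1)%N -> lambda t.+1 < psi l p ->
     let a := lambda (t - p + i)%N in
     let b := lambda t.+1 in
     a <= psi l.+1 i \/
     [/\ 0 < (a - psi l.+1 i) / (psi l.+1 i - b),
         (a - psi l.+1 i) / (psi l.+1 i - b) <=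
           chebyshev_factor k a b (lambda n) *
             ((a - psi l p) / (psi l p - b)) &
         forall x : nat -> 'cV[R[i]]_n,
           orthonormal_family n x ->
           (forall j : nat, (1 <= j <= n)%N ->
              A *m x j = (lambda j)%:C *: x j) ->
           let Yt := (orth_compl (\sum_((t - p + i).+1 <= j < t.+1) <[x j]>)
                        :&: Y l)%VS in
           (i <= \dim Yt)%N /\
           (forall (Yi : {vspace 'cV[R[i]]_n}) (eta : nat -> R),
              (Yi <= Yt)%VS -> \dim Yi = i -> ritz_values A Yi eta ->
              0 < (a - psi l.+1 i) / (psi l.+1 i - b) /\
              (a - psi l.+1 i) / (psi l.+1 i - b) <=
                chebyshev_factor k a b (lambda n) *
                  ((a - eta i) / (eta i - b)))])
  /\
  (forall t : nat, (i <= t <= n - p + i - 1)%N -> lambda t.+1 < psi l i ->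
     let a := lambda t in
     let b := lambda t.+1 in
     a <= psi l.+1 i \/
     (0 < (a - psi l.+1 i) / (psi l.+1 i - b) /\
      (a - psi l.+1 i) / (psi l.+1 i - b) <=
        chebyshev_factor k a b (lambda n) *
          ((a - psi l i) / (psi l i - b)))).
Proof.
have /andP[i1 ip] := hi.
have dimY m : \dim (Y m) = p by have [] := hY m.
have step m : lanczos_step A p k (Y m) (Y m.+1) by have [] := hY m.
have pn : (p <= n)%N.
  by rewrite -(dimY l) (leq_trans (dimvS (subvf _))) // dimvf /dim /= muln1.
have decr : nonincreasing_upto n lambda by case: hlambda.
have [x0 x0o x0E] := hermitian_eigenbasis hA hlambda.
have [decrY [y hy]] := ritz_values_system hA (hpsi l).
rewrite dimY in decrY hy.
split=> t /andP[t_ge t_le] b_psi a b.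
  have [a_le|psi_a] := leP a (psi l.+1 i); [by left | right].
  have hs : (1 <= t - p + i <= t)%N by lia.
  have tn : (t < n)%N by lia.
  have gapY w : w \in Y l -> 0 <= rayleigh_gap A (psi l p) w.
    by apply: (ritz_gap_ge0 hA hy); rewrite ?dimY.
  pose Yt x := (orth_compl (\sum_((t - p + i).+1 <= j < t.+1) <[x j]>) :&: Y l)%VS.
  have YtY x : (Yt x <= Y l)%VS by apply: capvSr.
  have Yt_orth (x : nat -> 'cV_n) w j : w \in Yt x ->
      (t - p + i < j <= t)%N -> inner (x j) w = 0.
    rewrite memv_cap => /andP[/mem_orth_compl wS _] hj.
    by apply/wS/mem_sum_lines; rewrite ltnS.
  have dimYt x : (i <= \dim (Yt x))%N.
    rewrite -(leq_add2r (p - i)) subnKC // -{1}(dimY l).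
    pose S := (\sum_((t - p + i).+1 <= j < t.+1) <[x j]>)%VS.
    apply: leq_trans (dim_orth_compl_cap S (Y l)) _; rewrite leq_add2l.
    by apply: leq_trans (dim_sum_lines _ _ _) _; lia.
  have [|pos bound] := lanczos_cluster_bound hA x0o x0E decr (step l) (hpsi l.+1) hi
    (YtY x0) (dimYt x0) hs tn (Yt_orth x0) _ b_psi psi_a.
    by move=> w /(subvP (YtY x0))/gapY.
  split=> // x xo xE Yt'; split=> [|Yi eta YiYt dimYi heta]; first exact: dimYt.
  have YiY : (Yi <= Y l)%VS := subv_trans YiYt (YtY x).
  have [decr_eta [z hz]] := ritz_values_system hA heta.
  rewrite dimYi in decr_eta hz.
  (* the tail condition b < eta i is inherited from Y l by min-max in Yi *)
  have psi_eta : psi l p <= eta i.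
    apply: (ritz_minmax hA hz _ decr_eta (subvv Yi)); rewrite ?dimYi ?i1 ?leqnn //.
    by move=> w /(subvP YiY)/gapY.
  apply: (lanczos_cluster_bound hA xo xE decr (step l) (hpsi l.+1) hi
    YiY _ hs tn) => //; rewrite ?dimYi //.
  - by move=> w j /(subvP YiYt); apply: Yt_orth.
  - by move=> w; apply: (ritz_gap_ge0 hA hz); rewrite ?dimYi.
  - exact: lt_le_trans psi_eta.
have [a_le|psi_a] := leP a (psi l.+1 i); [by left | right].
pose W := (\sum_(1 <= j < i.+1) <[y j]>)%VS.
have hW : ritz_system A W i (psi l) y := ritz_system_lines hy ip.
have WY : (W <= Y l)%VS.
  case: hy => _ yY _; apply: sum_lines_sub => j /andP[j1 ji].
  by apply: yY; rewrite j1 (leq_trans _ ip).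
have iW : (i <= \dim W)%N.
  by case: hW => yo yW _; apply: orthonormal_leq_dim yo yW.
apply: (lanczos_cluster_bound hA x0o x0E decr (step l) (hpsi l.+1) hi WY iW) => //.
- by lia.
- by lia.
- by move=> w j _; lia.
- move=> w; apply: (ritz_gap_ge0 hA hW).
    by apply: leq_trans (dim_sum_lines _ _ _) _; rewrite subn1.
  by move=> j r j1 jr ri; apply: decrY; rewrite // (leq_trans ri).
Qed.
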